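(* Let $(A,\mu)$ be a finite-dimensional left-symmetric color algebra over a field $k$ with respect to a skew-symmetric bicharacter $\epsilon$ of the abelian group $G$ over $k$, let $K$ be the field of fractions of $k[[\lambda]]$, and let $F_\lambda=f_0+\lambda f_1+\lambda^2f_2+\cdots$ be as described in the context. If $(A_K,F_\lambda)$ is a left-symmetric color algebra over $K$ with respect to $\epsilon$, then for all integers $p\geqslant 0$, $$\sum_{i,j\geqslant 0,\;i+j=p}\Big(f_i(f_j(x,y),z)-f_i(x,f_j(y,z))-\epsilon(|x|,|y|)\big(f_i(f_j(y,x),z)-f_i(y,f_j(x,z))\big)\Big)=0$$ for arbitrary homogeneous elements $x,y,z\in A_K$.
   Context: $G$ is written additively. A bicharacter of $G$ over a field $L$ is a map $\epsilon:G\times G\to L^\times$ that is multiplicative in each variable ($\epsilon(a,b+c)=\epsilon(a,b)\epsilon(a,c)$, $\epsilon(a+b,c)=\epsilon(a,c)\epsilon(b,c)$); it is skew-symmetric if $\epsilon(a,b)\epsilon(b,a)=1$. A left-symmetric color algebra over $L$ with respect to $\epsilon$ is a $G$-graded nonassociative $L$-algebra with $(xy)z-x(yz)=\epsilon(|x|,|y|)\big((yx)z-y(xz)\big)$ for all homogeneous $x,y,z$, where $|x|$ is the degree of $x$. $A_K=A\otimes_kK$ is graded by $(A_K)_a=A_a\otimes_kK$, and $\mu_K(x\otimes r,y\otimes s)=\mu(x,y)\otimes rs$. A $K$-bilinear map $F:A_K\times A_K\to A_K$ is defined over $k$ if there is a $k$-bilinear $f:A\times A\to A$ with $F(x\otimes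 r,y\otimes s)=f(x,y)\otimes rs$. In $F_\lambda(x,y)=f_0(x,y)+\lambda f_1(x,y)+\lambda^2f_2(x,y)+\cdots$ we have $f_0=\mu_K$, every $f_i:A_K\otimes_KA_K\to A_K$ is a homogeneous linear map of degree $0$ defined over $k$, and only finitely many $f_i$ are nonzero. *)

(* Defs.v *)
From HB Require Import structures.
From mathcomp Require Import all_boot all_order all_algebra.
From mathcomp Require Import boolp classical_sets.

Set Implicit Arguments.
Unset Strict Implicit.
Unset Printing Implicit Defensive.

Import GRing.Theory VectorInternalTheory.
Local Open Scope ring_scope.

Record fps (k : fieldType) := FPS { fps_coef : nat -> k }.

HB.instance Definition _ (k : fieldType) := gen_eqMixin (fps k).
HB.instance Definition _ (k : fieldType) := gen_choiceMixin (fps k).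

Section FormalPowerSeries.
Variable k : fieldType.
Implicit Types (f g h : fps k).

Definition fps_const (c : k) : fps k := FPS (fun n => if n == 0%N then c else 0).
Definition fps_var : fps k := FPS (fun n => (n == 1%N)%:R).
Definition fps_add f g : fps k := FPS (fun n => fps_coef f n + fps_coef g n).
Definition fps_opp f : fps k := FPS (fun n => - fps_coef f n).
Definition fps_mul f g : fps k :=
  FPS (fun n => \sum_(i < n.+1) fps_coef f i * fps_coef g (n - i)).

Lemma fpsP f g : fps_coef f =1 fps_coef g -> f = g.
Proof. by case: f g => [u] [v] /= /funext ->. Qed.

Let addA : associative fps_add.
Proof. by move=> f g h; apply: fpsP => n /=; rewrite addrA. Qed.
Let addC : commutative fps_add.
Proof. by move=> f g; apply: fpsP => n /=; rewrite addrC. Qed.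
Let add0 : left_id (fps_const 0) fps_add.
Proof. by move=> f; apply: fpsP => n /=; rewrite if_same add0r. Qed.
Let addN : left_inverse (fps_const 0) fps_opp fps_add.
Proof. by move=> f; apply: fpsP => n /=; rewrite if_same addNr. Qed.

HB.instance Definition _ := GRing.isZmodule.Build (fps k) addA addC add0 addN.

Let trunc n f : {poly k} := \poly_(i < n.+1) fps_coef f i.

Let coef_trunc n f i : (i <= n)%N -> (trunc n f)`_i = fps_coef f i.
Proof. by move=> le_in; rewrite coef_poly ltnS le_in. Qed.

Let coef_mul n f g i :
  (i <= n)%N -> fps_coef (fps_mul f g) i = (trunc n f * trunc n g)`_i.
Proof.
move=> le_in; rewrite coefM; apply: eq_bigr => j _.
rewrite !coef_trunc //; first exact: leq_trans (leq_subr _ _) le_in.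
by apply: leq_trans le_in; rewrite -ltnS.
Qed.

Let mulA : associative fps_mul.
Proof.
move=> f g h; apply: fpsP => n.
transitivity ((trunc n f * (trunc n g * trunc n h))`_n).
  rewrite coefM; apply: eq_bigr => i _.
  by rewrite -(coef_mul _ _ (leq_subr _ _)) coef_trunc // -ltnS.
rewrite mulrA coefM; apply: eq_bigr => i _.
by rewrite -coef_mul -1?ltnS // coef_trunc // leq_subr.
Qed.

Let mulC : commutative fps_mul.
Proof.
by move=> f g; apply: fpsP => n; rewrite !(coef_mul _ _ (leqnn n)) mulrC.
Qed.

Let mul1 : left_id (fps_const 1) fps_mul.
Proof.
move=> f; apply: fpsP => n /=; rewrite big_ord_recl /= mul1r subn0.
by rewrite big1 ?addr0 // => i _; rewrite mul0r.
Qed.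

Let mulDl : left_distributive fps_mul fps_add.
Proof.
move=> f g h; apply: fpsP => n /=; rewrite -big_split.
by apply: eq_bigr => i _; rewrite mulrDl.
Qed.

Let one_neq0 : fps_const 1 != 0.
Proof.
apply/eqP => /(congr1 (fun f => fps_coef f 0)) /= /eqP.
by rewrite oner_eq0.
Qed.

HB.instance Definition _ :=
  GRing.Zmodule_isComNzRing.Build (fps k) mulA mulC mul1 mulDl one_neq0.

(* Units and inverses are obtained from classical choice. *)
Let unit : {pred fps k} := fun f => `[< exists g, g * f = 1 >].
Let inv f : fps k :=
  if pselect (exists g, g * f = 1) is left h then projT1 (cid h) else f.

Let mulVx : {in unit, left_inverse 1 inv *%R}.
Proof.
move=> f /asboolP f_unit; rewrite /inv.
by case: pselect => // h; case: cid.
Qed.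
Let unitPl f g : g * f = 1 -> unit f.
Proof. by move=> gf1; apply/asboolP; exists g. Qed.
Let inv_out : {in [predC unit], inv =1 id}.
Proof.
move=> f; rewrite inE /= => /asboolP nf; rewrite /inv.
by case: pselect.
Qed.

HB.instance Definition _ :=
  GRing.ComNzRing_hasMulInverse.Build (fps k) mulVx unitPl inv_out.

Let order f : f != 0 ->
  exists2 n, fps_coef f n != 0 & forall i, (i < n)%N -> fps_coef f i = 0.
Proof.
move=> nz_f; have ex_n : exists n, fps_coef f n != 0.
  apply: contrapT => h; case/eqP: nz_f; apply: fpsP => n /=; rewrite if_same.
  by apply/eqP; apply: contrapT => /negP fn; apply: h; exists n.
case: (ex_minnP ex_n) => n fn min_n; exists n => // i lt_in.
by apply/eqP; apply: contraLR lt_in => /min_n; rewrite -leqNgt.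
Qed.

Let integral : GRing.integral_domain_axiom (fps k).
Proof.
move=> f g fg0; apply/norP => -[/order[m fm f0] /order[n gn g0]].
have := congr1 (fun h => fps_coef h (m + n)) fg0; rewrite /= if_same.
have lt_m : (m < (m + n).+1)%N by rewrite ltnS leq_addr.
rewrite (bigD1 (Ordinal lt_m)) //= addKn big1 ?addr0.
  by move/eqP; rewrite mulf_eq0 (negPf fm) (negPf gn).
move=> i ne_im; have [lt_im | lt_mi | eq_im] := ltngtP i m.
- by rewrite f0 ?mul0r.
- rewrite g0 ?mulr0 // ltn_subLR ?ltn_add2r //.
  by rewrite -ltnS ltn_ord.
- by case/eqP: ne_im; apply: val_inj.
Qed.

HB.instance Definition _ := GRing.ComUnitRing_isIntegral.Build (fps k) integral.

Let const_add : zmod_morphism fps_const.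
Proof. by move=> a b; apply: fpsP => -[|n] /=; rewrite ?subr0. Qed.
Let const_mul : monoid_morphism fps_const.
Proof.
split=> // a b; apply: fpsP => n /=; rewrite big_ord_recl /= subn0.
rewrite big1 ?addr0; first by case: n => [|n] /=; rewrite ?mulr0.
by move=> i _; rewrite mul0r.
Qed.

HB.instance Definition _ := GRing.isZmodMorphism.Build k (fps k) fps_const const_add.
HB.instance Definition _ := GRing.isMonoidMorphism.Build k (fps k) fps_const const_mul.

End FormalPowerSeries.

Notation laurent k := {fraction (fps k)}.

Definition laurent_const (k : fieldType) : {rmorphism k -> laurent k} :=
  @FracField.tofrac (fps k) \o @fps_const k.

Definition lambda (k : fieldType) : laurent k := FracField.tofrac (fps_var k).

Definition restrict_scalars (R S : nzRingType) (phi : {rmorphism R -> S})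
  (M : lmodType S) : Type := M.

Section RestrictScalars.
Variables (R S : nzRingType) (phi : {rmorphism R -> S}) (M : lmodType S).

HB.instance Definition _ := GRing.Zmodule.on (restrict_scalars phi M).

Let scale (c : R) (u : restrict_scalars phi M) : restrict_scalars phi M :=
  phi c *: (u : M).
Let scaleA a b u : scale a (scale b u) = scale (a * b) u.
Proof. by rewrite /scale scalerA rmorphM. Qed.
Let scale1 : left_id 1 scale.
Proof. by move=> u; rewrite /scale rmorph1 scale1r. Qed.
Let scaleDr : right_distributive scale +%R.
Proof. by move=> a u v; rewrite /scale scalerDr. Qed.
Let scaleDl u : {morph scale^~ u : a b / a + b}.
Proof. by move=> a b; rewrite /scale rmorphD scalerDl. Qed.

HB.instance Definition _ := GRing.Zmodule_isLmodule.Build R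
  (restrict_scalars phi M) scaleA scale1 scaleDr scaleDl.

End RestrictScalars.

(* A Prop-valued counterpart of the library's bilinear_for. *)
Definition is_bilinear (R : nzRingType) (U V W : lmodType R) (b : U -> V -> W) : Prop :=
  (forall v, linear (b^~ v)) /\ (forall u, linear (b u)).

Definition is_tensor_product (R : nzRingType) (U V T : lmodType R)
    (t : U -> V -> T) : Prop :=
  is_bilinear t /\
  forall (W : lmodType R) (b : U -> V -> W), is_bilinear b ->
    exists! h : T -> W, linear h /\ forall u v, h (t u v) = b u v.

Section ScalarExtension.
Variables (k L : fieldType) (phi : {rmorphism k -> L}).
Variables (A : lmodType k) (AL : lmodType L) (tens : A -> L -> AL).

(* AL, with x (x) r := tens x r, is the L-vector space A (x)_k L. *)
Definition is_scalar_extension : Prop :=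
  @is_tensor_product k A (restrict_scalars phi L^o) (restrict_scalars phi AL) tens
  /\ forall x (r s : L), tens x (s * r) = s *: tens x r.

Definition extends_bilinear (g : A -> A -> A) (F : AL -> AL -> AL) : Prop :=
  forall x y (r s : L), F (tens x r) (tens y s) = tens (g x y) (r * s).

Definition defined_over (F : AL -> AL -> AL) : Prop :=
  exists2 g : A -> A -> A, is_bilinear g & extends_bilinear g F.

(* The image of S (x)_k L in A (x)_k L, for S a subspace of A. *)
Definition extend_subspace (S : set A) : set AL := fun u =>
  exists (n : nat) (x : 'I_n -> A) (r : 'I_n -> L),
    (forall i, S (x i)) /\ u = \sum_(i < n) tens (x i) (r i).

End ScalarExtension.

Lemma scalar_extension_exists (k L : fieldType) (phi : {rmorphism k -> L})
    (A : vectType k) :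
  exists (AL : lmodType L) (tens : A -> L -> AL), is_scalar_extension phi tens.
Proof.
pose n := dim A; pose t (x : A) (r : L) : 'rV[L]_n := r *: map_mx phi (v2r x).
exists 'rV[L]_n, t; split; last by move=> x r s; rewrite /t scalerA.
split.
  split=> [r c x y | x c r s].
    rewrite /t linearP map_mxD map_mxZ scalerDr !scalerA mulrC.
    by congr (_ + _); rewrite -scalerA.
  by rewrite /t /= scalerDl /= -[in LHS]scalerA.
move=> W b [bl br].
pose e (j : 'I_n) : A := @r2v k A (delta_mx 0 j).
have tE (u : 'rV[L]_n) : u = \sum_j t (e j) (u 0 j).
  rewrite {1}(row_sum_delta u); apply: eq_bigr => j _.
  by rewrite /t /e r2vK map_delta_mx.
have lin_sum (U V : lmodType k) (h : U -> V) : linear h ->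
    forall I (s : seq I) (F : I -> U), h (\sum_(i <- s) F i) = \sum_(i <- s) h (F i).
  move=> hl I s F.
  have hD u v : h (u + v) = h u + h v by have := hl 1 u v; rewrite !scale1r.
  have h0 : h 0 = 0 by apply: (addrI (h 0)); rewrite -hD !addr0.
  exact: (big_morph h hD h0).
have linZ (U V : lmodType k) (h : U -> V) : linear h -> forall c u, h (c *: u) = c *: h u.
  move=> hl c u; have h0 : h 0 = 0.
    by apply: (addrI (h 0)); have := hl 1 0 0; rewrite !scale1r !addr0.
  by rewrite -[c *: u]addr0 hl h0 addr0.
pose h (u : restrict_scalars phi 'rV[L]_n) : W := \sum_j b (e j) ((u : 'rV[L]_n) 0 j).
exists h; split; first split.
- move=> c u v; rewrite /h scaler_sumr -big_split /=; apply: eq_bigr => j _.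
  by rewrite -br; congr (b _ _); rewrite !mxE.
- move=> x r; rewrite /h.
  have {2}-> : x = \sum_j (v2r x) 0 j *: e j.
    rewrite -{1}[x]v2rK {1}(row_sum_delta (v2r x)) linear_sum.
    by apply: eq_bigr => j _; rewrite linearZ.
  rewrite (lin_sum _ _ _ (bl r)); apply: eq_bigr => j _.
  rewrite (linZ _ _ _ (bl r)) -(linZ _ _ _ (br (e j))).
  by congr (b _ _); rewrite !mxE mulrC.
move=> h' [h'l h'E]; apply: funext => u.
rewrite [in RHS](tE u) (lin_sum _ _ _ h'l) /h.
by apply: eq_bigr => j _; rewrite h'E.
Qed.

Section ColorAlgebras.
Variables (L : fieldType) (G : zmodType).

(* The values lie in the unit group of L. *)
Definition is_bicharacter (eps : G -> G -> L) : Prop :=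
  [/\ forall a b, eps a b != 0,
      forall a b c, eps a (b + c) = eps a b * eps a c
    & forall a b c, eps (a + b) c = eps a c * eps b c].

Definition is_skew_symmetric (eps : G -> G -> L) : Prop :=
  forall a b, eps a b * eps b a = 1.

Variable V : lmodType L.

Definition is_subspace (S : set V) : Prop :=
  S 0 /\ forall (c : L) u v, S u -> S v -> S (c *: u + v).

Definition is_grading (V_ : G -> set V) : Prop :=
  [/\ forall a, is_subspace (V_ a),
      forall v, exists (s : seq G) (w : G -> V),
        (forall a, V_ a (w a)) /\ v = \sum_(a <- s) w a
    & forall (s : seq G) (w : G -> V), uniq s -> (forall a, V_ a (w a)) ->
        \sum_(a <- s) w a = 0 -> {in s, forall a, w a = 0}].

Definition is_degree0 (V_ : G -> set V) (mu : V -> V -> V) : Prop :=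
  forall a b x y, V_ a x -> V_ b y -> V_ (a + b) (mu x y).

Record left_symmetric_color_algebra (eps : G -> G -> L) (V_ : G -> set V)
    (mu : V -> V -> V) : Prop := LeftSymmetricColorAlgebra {
  lsca_grading : is_grading V_;
  lsca_bilinear : is_bilinear mu;
  lsca_degree0 : is_degree0 V_ mu;
  lsca_identity : forall a b c x y z, V_ a x -> V_ b y -> V_ c z ->
    mu (mu x y) z - mu x (mu y z) =
    eps a b *: (mu (mu y x) z - mu y (mu x z))
}.

End ColorAlgebras.

(* Main.v *)
Require Import Defs.
From mathcomp Require Import all_boot all_order all_algebra.
From mathcomp Require Import boolp classical_sets.

Set Implicit Arguments.
Unset Strict Implicit.
Unset Printing Implicit Defensive.

Import GRing.Theory.
Local Open Scope ring_scope.

(** The color associator below measures the failure of left-symmetry, and it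
    is bilinear in the pair of products.  Hence the left-symmetry of
    [F = \sum_i lambda ^+ i *: f_i] reads
    [\sum_(i, j) lambda ^+ (i + j) *: T i j x y z = 0], where [T i j] is the
    color associator of the pair [f_i], [f_j], and the theorem is the vanishing
    of the coefficient of [lambda ^+ p].  Comparing coefficients is not
    legitimate for arbitrary vectors of [AK], since [lambda] is itself a scalar
    there; this is where the [f_i] being defined over [k] enters.

    The [T i j] are additive in each argument, so [x], [y], [z] may be taken to
    be pure tensors (lemma [extend_subspace_ind]).  On pure tensors [T i j]
    takes values in the extension of the same expression [d i j] formed in [A]
    ([color_associator_tens]), so that it is enough to treat [x (x) 1],
    [y (x) 1], [z (x) 1].  For these the identity becomes
    [\sum_(i, j) tens (d i j) (lambda ^+ (i + j)) = 0] with [d i j] in [A], and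
    the powers of [lambda] are linearly independent over [k]: extending each
    coordinate form of [A] to [AK] turns this equation into an equality of
    power series, whose coefficients vanish ([tens_lambda_exp_free]). *)

(** * Additive and bilinear maps *)

Lemma linear_sumE (R : nzRingType) (U V : lmodType R) (h : U -> V) :
  linear h -> forall I (s : seq I) (P : pred I) (E : I -> U),
  h (\sum_(i <- s | P i) E i) = \sum_(i <- s | P i) h (E i).
Proof.
move=> hl I s P E.
have hD u v : h (u + v) = h u + h v by have := hl 1 u v; rewrite !scale1r.
have h0 : h 0 = 0 by apply: (addrI (h 0)); rewrite -hD !addr0.
exact: (big_morph h hD h0).
Qed.

Lemma linear_scaleE (R : nzRingType) (U V : lmodType R) (h : U -> V) :
  linear h -> forall c u, h (c *: u) = c *: h u.
Proof.
move=> hl c u.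
have h0 : h 0 = 0 by have := linear_sumE hl [::] xpredT id; rewrite !big_nil.
by rewrite -[c *: u]addr0 hl h0 addr0.
Qed.

Section Bilinear.
Variables (R : nzRingType) (U V W : lmodType R) (b : U -> V -> W).
Hypothesis b_bil : is_bilinear b.

Lemma bilinear_suml I (s : seq I) (P : pred I) (E : I -> U) v :
  b (\sum_(i <- s | P i) E i) v = \sum_(i <- s | P i) b (E i) v.
Proof. exact: (linear_sumE (b_bil.1 v)). Qed.

Lemma bilinear_sumr I (s : seq I) (P : pred I) (E : I -> V) u :
  b u (\sum_(i <- s | P i) E i) = \sum_(i <- s | P i) b u (E i).
Proof. exact: (linear_sumE (b_bil.2 u)). Qed.

Lemma bilinear_scalel c u v : b (c *: u) v = c *: b u v.
Proof. exact: (linear_scaleE (b_bil.1 v)). Qed.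

Lemma bilinear_scaler c u v : b u (c *: v) = c *: b u v.
Proof. exact: (linear_scaleE (b_bil.2 u)). Qed.

End Bilinear.

(** * The color associator of a pair of products *)

(** Left-symmetry of a product [m] is the vanishing of this expression for
    [m1 = m2 = m] and [e = eps a b]; polarizing to two products makes it
    bilinear in the product. *)
Definition color_associator (L : nzRingType) (V : lmodType L) (e : L)
    (m1 m2 : V -> V -> V) (x y z : V) : V :=
  m1 (m2 x y) z - m1 x (m2 y z) - e *: (m1 (m2 y x) z - m1 y (m2 x z)).

Section ColorAssociator.
Variables (L : fieldType) (V : lmodType L) (e : L).

Section Additivity.
Variables (m1 m2 : V -> V -> V).
Hypotheses (m1_bil : is_bilinear m1) (m2_bil : is_bilinear m2).

Let bilE := (bilinear_suml m1_bil, bilinear_sumr m1_bil,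
             bilinear_suml m2_bil, bilinear_sumr m2_bil).

Lemma color_associator_suml n (E : 'I_n -> V) y z :
  color_associator e m1 m2 (\sum_i E i) y z =
  \sum_i color_associator e m1 m2 (E i) y z.
Proof. by rewrite /color_associator !bilE -!sumrB scaler_sumr -sumrB. Qed.

Lemma color_associator_summ n (E : 'I_n -> V) x z :
  color_associator e m1 m2 x (\sum_i E i) z =
  \sum_i color_associator e m1 m2 x (E i) z.
Proof. by rewrite /color_associator !bilE -!sumrB scaler_sumr -sumrB. Qed.

Lemma color_associator_sumr n (E : 'I_n -> V) x y :
  color_associator e m1 m2 x y (\sum_i E i) =
  \sum_i color_associator e m1 m2 x y (E i).
Proof. by rewrite /color_associator !bilE -!sumrB scaler_sumr -sumrB. Qed.

End Additivity.

Lemma color_associator_series (f : nat -> V -> V -> V) (l : L) (n : nat) :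
  (forall i, is_bilinear (f i)) ->
  let F x y := \sum_(i < n) l ^+ i *: f i x y in
  forall x y z, color_associator e F F x y z =
    \sum_(ij : 'I_n * 'I_n)
      l ^+ (ij.1 + ij.2) *: color_associator e (f ij.1) (f ij.2) x y z.
Proof.
move=> f_bil F x y z.
have FFl u v w : F (F u v) w =
    \sum_(ij : 'I_n * 'I_n) l ^+ (ij.1 + ij.2) *: f ij.1 (f ij.2 u v) w.
  rewrite -(pair_bigA _ (fun i j : 'I_n => l ^+ (i + j) *: f i (f j u v) w)).
  apply: eq_bigr => i _; rewrite (bilinear_suml (f_bil i)) scaler_sumr.
  by apply: eq_bigr => j _; rewrite (bilinear_scalel (f_bil i)) scalerA exprD.
have FFr u v w : F u (F v w) =
    \sum_(ij : 'I_n * 'I_n) l ^+ (ij.1 + ij.2) *: f ij.1 u (f ij.2 v w).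
  rewrite -(pair_bigA _ (fun i j : 'I_n => l ^+ (i + j) *: f i u (f j v w))).
  apply: eq_bigr => i _; rewrite (bilinear_sumr (f_bil i)) scaler_sumr.
  by apply: eq_bigr => j _; rewrite (bilinear_scaler (f_bil i)) scalerA exprD.
rewrite /color_associator !FFl !FFr -!sumrB scaler_sumr -sumrB.
apply: eq_bigr => -[i j] _ /=.
by rewrite !scalerBr !scalerA [e * _]mulrC.
Qed.

End ColorAssociator.

(** * Scalar extensions *)

Section ScalarExtensionTheory.
Variables (k L : fieldType) (phi : {rmorphism k -> L}).
Variables (A : lmodType k) (AL : lmodType L) (tens : A -> L -> AL).
Hypothesis tensP : is_scalar_extension phi tens.

Lemma tens_suml I (s : seq I) (P : pred I) (E : I -> A) r :
  tens (\sum_(i <- s | P i) E i) r = \sum_(i <- s | P i) tens (E i) r.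
Proof. exact: (bilinear_suml tensP.1.1). Qed.

Lemma tens_subl x y r : tens (x - y) r = tens x r - tens y r.
Proof.
have [[/(_ r) tl _] _] := tensP.1.
by have := tl (-1) y x; rewrite !scaleN1r [- y + x]addrC => ->; rewrite addrC.
Qed.

Lemma tens_scalel c x r : tens (c *: x) r = phi c *: tens x r.
Proof. exact: (bilinear_scalel tensP.1.1). Qed.

(** The universal property applied to [(x, r) |-> phi (l x) * r]. These forms
    turn a relation between tensors into relations between scalars of [L]. *)
Lemma extend_linear_form (l : A -> k) : scalar l ->
  exists h : AL -> L,
    (forall (I : finType) (u : I -> AL), h (\sum_i u i) = \sum_i h (u i)) /\
    forall x r, h (tens x r) = phi (l x) * r.
Proof.
move=> l_lin; pose b x r : restrict_scalars phi L^o := phi (l x) * r.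
have b_bil : @is_bilinear k A (restrict_scalars phi L^o) (restrict_scalars phi L^o) b.
  split=> [r c x y | x c r s].
    by rewrite /b l_lin rmorphD rmorphM mulrDl -mulrA.
  by rewrite /b mulrDr; congr (_ + _); rewrite mulrCA.
have [h [[h_lin hE] _]] := tensP.1.2 _ _ b_bil.
exists h; split=> // I u.
exact: (linear_sumE h_lin).
Qed.

Lemma extend_subspace_ind (S : set A) (P : AL -> Prop) :
  (forall n (u : 'I_n -> AL), (forall i, P (u i)) -> P (\sum_i u i)) ->
  (forall x r, S x -> P (tens x r)) ->
  forall u, extend_subspace tens S u -> P u.
Proof.
move=> Psum Ptens _ [n [x [r [Sx ->]]]].
by apply: Psum => i; apply: Ptens.
Qed.

(** The last two terms multiply [s], [r], [t] in that order; commutativity of [L]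
    gives all four the same scalar factor, so the expression descends to [A]. *)
Lemma color_associator_tens (e : k) (m1 m2 : AL -> AL -> AL)
    (g1 g2 : A -> A -> A) :
  extends_bilinear tens g1 m1 -> extends_bilinear tens g2 m2 ->
  forall x y z r s t,
  color_associator (phi e) m1 m2 (tens x r) (tens y s) (tens z t) =
  tens (color_associator e g1 g2 x y z) (r * s * t).
Proof.
move=> m1E m2E x y z r s t.
rewrite /color_associator !m2E !m1E [s * r]mulrC [s * (r * t)]mulrCA !mulrA.
by rewrite !(tens_subl, tens_scalel).
Qed.

End ScalarExtensionTheory.

(** * Powers of the variable are independent over the base field *)

Section PowersOfLambda.
Variable k : fieldType.

Lemma fps_coef_sum I (s : seq I) (P : pred I) (E : I -> fps k) p :
  fps_coef (\sum_(i <- s | P i) E i) p = \sum_(i <- s | P i) fps_coef (E i) p.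
Proof.
apply: (big_morph (fun g : fps k => fps_coef g p)) => //=.
by rewrite if_same.
Qed.

Lemma fps_coef_varM (g : fps k) p :
  fps_coef (fps_var k * g) p = if p is q.+1 then fps_coef g q else 0.
Proof.
case: p => [|p]; first by rewrite /= big_ord1 /= mul0r.
rewrite /= !big_ord_recl /= mul0r add0r mul1r subSS subn0 big1 ?addr0 // => i _.
by rewrite mul0r.
Qed.

Lemma fps_coef_monomial (c : k) n p :
  fps_coef (fps_const c * fps_var k ^+ n) p = if n == p then c else 0.
Proof.
elim: n p => [|n IHn] p; first by rewrite mulr1 /= eq_sym.
by rewrite exprS mulrCA fps_coef_varM; case: p => [|p] //; rewrite IHn.
Qed.

(** A relation between powers of [lambda] over [k] already holds in the subring
    of power series, where coefficients can be read off. *)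
Lemma lambda_exp_free (I : finType) (c : I -> k) (w : I -> nat) :
  \sum_i laurent_const k (c i) * lambda k ^+ w i = 0 ->
  forall p, \sum_(i | w i == p) c i = 0.
Proof.
move=> sum0 p.
have /eqP : FracField.tofrac (\sum_i fps_const (c i) * fps_var k ^+ w i) = 0.
  rewrite rmorph_sum /= -[RHS]sum0; apply: eq_bigr => i _.
  by rewrite rmorphM rmorphXn.
rewrite tofrac_eq0 => /eqP /(congr1 (fun g : fps k => fps_coef g p)).
rewrite fps_coef_sum [RHS]if_same => coef0; rewrite -[RHS]coef0 big_mkcond.
by apply: eq_bigr => i _; rewrite fps_coef_monomial.
Qed.

Lemma tens_lambda_exp_free (A : vectType k) (AK : lmodType (laurent k))
    (tens : A -> laurent k -> AK) : is_scalar_extension (laurent_const k) tens ->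
  forall (I : finType) (d : I -> A) (w : I -> nat),
  \sum_i tens (d i) (lambda k ^+ w i) = 0 ->
  forall p, \sum_(i | w i == p) d i = 0.
Proof.
move=> tensP I d w sum0 p.
rewrite [LHS](coord_vbasis (memvf _)) big1 // => j _.
have coord_lin : scalar (coord (vbasis {:A}) j) by move=> c u v; rewrite linearP.
have [h [h_sum hE]] := extend_linear_form tensP coord_lin.
rewrite linear_sum /= (lambda_exp_free _ p) ?scale0r //.
have h0 : h 0 = 0 by have := h_sum 'I_0 (fun=> 0); rewrite !big_ord0.
by rewrite -[RHS]h0 -sum0 h_sum; apply: eq_bigr => i _; rewrite hE.
Qed.

End PowersOfLambda.

(** * Comparing coefficients *)

Lemma sum_antidiagonal_square (V : nmodType) (E : nat -> nat -> V) p n :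
  (p < n)%N ->
  \sum_(i < p.+1) \sum_(j < p.+1 | (i + j == p)%N) E i j =
  \sum_(ij : 'I_n * 'I_n | (ij.1 + ij.2 == p)%N) E ij.1 ij.2.
Proof.
move=> lt_pn.
rewrite -(pair_big_dep xpredT (fun i j : 'I_n => (i + j == p)%N) (fun i j => E i j)).
rewrite (big_ord_widen n (fun i => \sum_(j < p.+1 | (i + j == p)%N) E i j)) //.
rewrite big_mkcond; apply: eq_bigr => i _; case: ifP => [lt_ip | /negbT ge_ip].
  rewrite (big_ord_widen_cond n (fun j => i + j == p)%N (E i)) //.
  apply: eq_bigl => j; case: eqP => //= <-.
  by rewrite ltnS leq_addl.
rewrite big1 // => j /eqP ijp; case/negP: ge_ip.
by rewrite -ijp ltnS leq_addr.
Qed.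

Theorem proposition3p1 (k : fieldType) (G : zmodType) (eps : G -> G -> k)
    (eps_bichar : is_bicharacter eps) (eps_skew : is_skew_symmetric eps)
    (A : vectType k) (A_ : G -> set A) (mu : A -> A -> A)
    (A_lsca : left_symmetric_color_algebra eps A_ mu)
    (AK : lmodType (laurent k)) (tens : A -> laurent k -> AK)
    (AK_tens : is_scalar_extension (laurent_const k) tens)
    (f : nat -> AK -> AK -> AK)
    (f_bilinear : forall i, is_bilinear (f i))
    (f_degree0 : forall i, is_degree0 (fun a => extend_subspace tens (A_ a)) (f i))
    (f_defined : forall i, defined_over tens (f i))
    (f0_mu : extends_bilinear tens mu (f 0%N))
    (N : nat) (f_finite : forall i, (N <= i)%N -> forall x y, f i x y = 0)
    (F_lsca : left_symmetric_color_algebra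
       (fun a b => laurent_const k (eps a b))
       (fun a => extend_subspace tens (A_ a))
       (fun x y => \sum_(i < N) lambda k ^+ i *: f i x y)) :
  forall (p : nat) (a b c : G) (x y z : AK),
    extend_subspace tens (A_ a) x ->
    extend_subspace tens (A_ b) y ->
    extend_subspace tens (A_ c) z ->
    \sum_(i < p.+1) \sum_(j < p.+1 | (i + j == p)%N)
      (f i (f j x y) z - f i x (f j y z)
       - laurent_const k (eps a b) *: (f i (f j y x) z - f i y (f j x z))) = 0.
Proof.
move=> p a b c x y z Ax Ay Az.
pose l := lambda k; pose e := laurent_const k (eps a b).
pose F n x y := \sum_(i < n) l ^+ i *: f i x y.
pose n := (N + p.+1)%N.
pose T i j x y z := color_associator e (f i) (f j) x y z.
rewrite (@sum_antidiagonal_square _ (fun i j => T i j x y z) p n) ?leq_addl //.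
(* Padding the series with zeros up to [n] makes the whole antidiagonal
   [i + j = p] appear in its expansion. *)
have FE u v : \sum_(i < N) l ^+ i *: f i u v = F n u v.
  rewrite /F (big_ord_widen n (fun i => l ^+ i *: f i u v)) ?leq_addr //.
  rewrite big_mkcond; apply: eq_bigr => i _; case: ifP => // /negbT.
  by rewrite -leqNgt => /f_finite ->; rewrite scaler0.
have F_identity u v w : extend_subspace tens (A_ a) u ->
    extend_subspace tens (A_ b) v -> extend_subspace tens (A_ c) w ->
    color_associator e (F n) (F n) u v w = 0.
  move=> Au Av Aw; have := lsca_identity F_lsca Au Av Aw.
  by rewrite /= !FE => /eqP; rewrite -subr_eq0 => /eqP.
have exchange0 m (E : 'I_m -> nat -> nat -> AK) :
    (forall h, \sum_(ij : 'I_n * 'I_n | (ij.1 + ij.2 == p)%N) E h ij.1 ij.2 = 0) ->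
    \sum_(ij : 'I_n * 'I_n | (ij.1 + ij.2 == p)%N) \sum_h E h ij.1 ij.2 = 0.
  by move=> E0; rewrite exchange_big big1.
move: x Ax; apply: extend_subspace_ind => [m u u0 | x r Ax].
  rewrite -[RHS](exchange0 m (fun h i j => T i j (u h) y z) u0).
  by apply: eq_bigr => ij _; apply: color_associator_suml.
move: y Ay; apply: extend_subspace_ind => [m u u0 | y s Ay].
  rewrite -[RHS](exchange0 m (fun h i j => T i j (tens x r) (u h) z) u0).
  by apply: eq_bigr => ij _; apply: color_associator_summ.
move: z Az; apply: extend_subspace_ind => [m u u0 | z t Az].
  rewrite -[RHS](exchange0 m (fun h i j => T i j (tens x r) (tens y s) (u h)) u0).
  by apply: eq_bigr => ij _; apply: color_associator_sumr.
have [|g gE] := @choice _ _ (fun i gi => extends_bilinear tens gi (f i)).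
  by move=> i; have [gi _ giE] := f_defined i; exists gi.
(* The identity is used at the tensors with scalar part 1, where the only
   scalars left from [laurent k] are the powers of [lambda]. *)
pose d (ij : 'I_n * 'I_n) := color_associator (eps a b) (g ij.1) (g ij.2) x y z.
have d_sum0 : \sum_(ij : 'I_n * 'I_n | (ij.1 + ij.2 == p)%N) d ij = 0.
  apply: (tens_lambda_exp_free AK_tens (w := fun ij : 'I_n * 'I_n => (ij.1 + ij.2)%N)).
  have tens1 (S : set A) v : S v -> extend_subspace tens S (tens v 1).
    by move=> Sv; exists 1%N, (fun=> v), (fun=> 1); rewrite big_ord1.
  rewrite -[RHS](F_identity _ _ _ (tens1 _ _ Ax) (tens1 _ _ Ay) (tens1 _ _ Az)).
  rewrite color_associator_series //; apply: eq_bigr => ij _.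
  by rewrite (color_associator_tens AK_tens _ (gE _) (gE _)) !mulr1 -AK_tens.2 mulr1.
transitivity (tens (\sum_(ij : 'I_n * 'I_n | (ij.1 + ij.2 == p)%N) d ij) (r * s * t)).
  rewrite (tens_suml AK_tens); apply: eq_bigr => ij _.
  exact: (color_associator_tens AK_tens _ (gE _) (gE _)).
have := tens_suml AK_tens [::] xpredT id (r * s * t).
by rewrite !big_nil d_sum0.
Qed.
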